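(* A uniformly recurrent infinite word $u$ over a finite alphabet has property $R_3$ (every factor has exactly three return words) if and only if $C(n)=2n+1$ for all $n\ge0$ and $u$ has no weak bispecial factor.
   Context: Factors of $u=u_0u_1\cdots$ are finite (possibly empty) words occurring in $u$; $C(n)$ is the number of factors of length $n$. $u$ is uniformly recurrent if for every $n$ every sufficiently long factor contains all factors of length $n$. For a factor $w$, $\mathcal E_\ell(w)=\{a: aw \text{ is a factor}\}$, $\mathcal E_r(w)=\{b: wb\text{ is a factor}\}$. If $j<k$ are successive occurrences of $w$ (positions $j$ with $u_j\cdots u_{j+|w|-1}=w$), then $u_j\cdots u_{k-1}$ is a return word of $w$. The bilateral order of $w$ is $B(w)=\#\{awb \text{ factor of } u: a,b \text{ letters}\}-\#\mathcal E_\ell(w)-\#\mathcal E_r(w)+1$, and $w$ is weak bispecial if $B(w)<0$. *)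

(* Defs.v *)
From mathcomp Require Import all_boot all_order all_algebra.
From mathcomp Require Import boolp classical_sets cardinality.
Set Implicit Arguments.
Unset Strict Implicit.
Unset Printing Implicit Defensive.
Import Order.TTheory GRing.Theory Num.Theory.

(* An infinite word over the finite alphabet A is a function u : nat -> A.
   Letters of A are not required to occur in u. *)

(* The word u_j u_{j+1} ... u_{j+n-1}. *)
Definition window (A : finType) (u : nat -> A) (j n : nat) : seq A :=
  [seq u i | i <- iota j n].

Definition occurrence (A : finType) (u : nat -> A) (w : seq A) (j : nat) : Prop :=
  window u j (size w) = w.

Definition factor (A : finType) (u : nat -> A) (w : seq A) : Prop :=
  exists j, occurrence u w j.

Definition complexity (A : finType) (u : nat -> A) (n : nat) : nat :=
  #|[set w : n.-tuple A | `[< factor u w >]]|.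

Definition uniformly_recurrent (A : finType) (u : nat -> A) : Prop :=
  forall n : nat, exists N : nat, forall v : seq A,
    factor u v -> N <= size v ->
    forall w : seq A, factor u w -> size w = n -> infix w v.

Definition successive_occurrences (A : finType) (u : nat -> A) (w : seq A)
    (j k : nat) : Prop :=
  [/\ j < k, occurrence u w j, occurrence u w k &
      forall i, j < i < k -> ~ occurrence u w i].

Definition return_words (A : finType) (u : nat -> A) (w : seq A) : set (seq A) :=
  [set r | exists j k, successive_occurrences u w j k /\ r = window u j (k - j)]%classic.

(* The empty word is a factor, occurring at every position; its return words
   are the letters of u. *)
Definition property_R (m : nat) (A : finType) (u : nat -> A) : Prop :=
  forall w : seq A, factor u w -> (return_words u w #= `I_m)%card.

Definition left_extensions (A : finType) (u : nat -> A) (w : seq A) : {set A} :=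
  [set a | `[< factor u (a :: w) >]].

Definition right_extensions (A : finType) (u : nat -> A) (w : seq A) : {set A} :=
  [set b | `[< factor u (rcons w b) >]].

(* The words a w b are counted through the pairs (a, b), which they determine. *)
Definition bilateral_extensions (A : finType) (u : nat -> A) (w : seq A) :
    {set A * A} :=
  [set ab | `[< factor u (ab.1 :: rcons w ab.2) >]].

Definition bilateral_order (A : finType) (u : nat -> A) (w : seq A) : int :=
  (#|bilateral_extensions u w|%:Z - #|left_extensions u w|%:Z
   - #|right_extensions u w|%:Z + 1)%R.

Definition weak_bispecial (A : finType) (u : nat -> A) (w : seq A) : Prop :=
  factor u w /\ (bilateral_order u w < 0)%R.

(* Main.v *)
(* Let excess x = #E_r(x) - 1. Reading the return words of w as a trie, whose
   inner nodes are the factors in which w occurs exactly once, as a prefix,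
   shows that #Ret(w) = 1 + the sum of the excesses of these nodes. So R_3 says
   that for every factor w this sum, the "budget" of w, is 2. On the other hand
   B(w) = sum_a excess (a w) - excess w, and C(n+1) - C(n) is the total excess
   of the words of length n.

   If C(n) = 2n+1 and no factor is weak, all bilateral orders vanish, so that
   excess is preserved under left extension. Every long word has exactly one
   suffix among the nodes of w, hence the budget of w is excess(empty) = 2.

   Conversely, R_3 leaves excess w in {0, 1, 2}, and in each case the budgets of
   w, of its left extensions and of one right extension force B(w) = 0. *)
Require Import Defs.
From mathcomp Require Import all_boot all_order all_algebra.
From mathcomp Require Import boolp classical_sets cardinality.
From mathcomp Require Import zify.
Set Implicit Arguments.
Unset Strict Implicit.
Unset Printing Implicit Defensive.

(** * Words in which a given word occurs exactly once, as a prefix *)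

Section Lone.
Variable A : eqType.
Implicit Types w x y s t : seq A.

Lemma prefix_total p q x :
  prefix p x -> prefix q x -> size p <= size q -> prefix p q.
Proof.
move=> px /prefixP[r xE]; move: px; rewrite {}xE !prefixE take_cat.
by case: ltngtP => // ->; rewrite subnn take0 cats0 take_size.
Qed.

(* w occurs in x exactly once, and as a prefix. *)
Definition lone w x :=
  prefix w x && all (fun i => ~~ prefix w (drop i x)) (iota 1 (size x)).

Lemma loneP w x :
  reflect (prefix w x /\ forall i, 0 < i <= size x -> ~~ prefix w (drop i x))
          (lone w x).
Proof.
apply: (iffP andP) => -[wx lx]; split=> //.
  by move=> i Hi; apply: (allP lx); rewrite mem_iota; lia.
by apply/allP => i; rewrite mem_iota => Hi; apply: lx; lia.
Qed.

Lemma lone_pre w x : lone w x -> prefix w x.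
Proof. by case/andP. Qed.

Lemma lone_catK w s t : lone w (s ++ t) -> prefix w t -> s = [::].
Proof.
case/loneP=> _ /(_ (size s)); rewrite drop_size_cat //.
case: s => //= a s H wt; rewrite wt size_cat in H.
by have: ~~ true by apply: H; lia.
Qed.

Lemma lone_refl w : lone w w.
Proof.
apply/loneP; split=> [|i Hi]; first exact: prefix_refl.
apply/negP => /size_prefix; rewrite size_drop; lia.
Qed.

Lemma lone_prefix w x y :
  lone w y -> prefix x y -> size w <= size x -> lone w x.
Proof.
move=> /loneP[wy ly] /prefixP[z yE] wx; subst y.
apply/loneP; split.
  by apply: prefix_total wy _ wx; exact: prefix_prefix.
move=> i Hi; apply/negP => wi; have := ly i.
have Hp : 0 < i <= size (x ++ z) by rewrite size_cat; lia.
move/(_ Hp)/negP; apply; rewrite drop_cat; case: ltnP => Hi'.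
  exact: prefix_catl.
by move: wi; rewrite drop_oversize // prefixs0 => /eqP ->; exact: prefix0s.
Qed.

(** Cutting [x] at its last occurrence of [w] gives [t]; this is how a word containing [w] acquires
    a suffix in the trie of [w]. *)
Lemma last_occurrence w x : infix w x -> exists s t, x = s ++ t /\ lone w t.
Proof.
elim: x => [|a x IH].
  by rewrite infixs0 => /eqP ->; exists [::], [::].
rewrite infix_consl; case: (boolP (infix w x)) => [/IH[s [t [-> lt]]] _|nwx].
  by exists (a :: s), t.
rewrite orbF => wx; exists [::], (a :: x); split=> //.
apply/loneP; split=> // -[|i] //= Hi; apply: contra nwx => wi.
by rewrite -(cat_take_drop i x) infix_catl // prefixW.
Qed.

Lemma lone_suffix w x : lone w x -> suffix w x -> x = w.
Proof.
by move=> lx /suffixP[s xE]; rewrite xE in lx *; rewrite (lone_catK lx (prefix_refl _)).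
Qed.

Lemma prefix_rconsE w x b :
  prefix w (rcons x b) = prefix w x || (w == rcons x b).
Proof.
apply/idP/orP => [/prefixP[z]|[/prefix_trans -> //|/eqP ->]]; last 2 first.
- exact: prefix_rcons.
- exact: prefix_refl.
case/lastP: z => [|z c]; first by rewrite cats0 => ->; right.
by rewrite -rcons_cat => /rcons_inj[-> _]; left; exact: prefix_prefix.
Qed.

(** A new last letter creates at most one occurrence of [w], the one ending there. So an extension
    of a node is either a node again or ends in [w]. *)
Lemma lone_rcons w x b : size w <= size x ->
  lone w (rcons x b) = lone w x && ~~ suffix w (rcons x b).
Proof.
move=> wx; apply/idP/andP => [lx|[/loneP[px lx] sx]].
  split; first by apply: lone_prefix lx _ wx; exact: prefix_rcons.
  apply/negP => /(lone_suffix lx) E; move: wx; rewrite -E size_rcons; lia.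
apply/loneP; split; first by rewrite -cats1 prefix_catl.
move=> i; rewrite size_rcons => Hi; apply/negP => wi.
have [Hi'|Hi'] := leqP i (size x); last first.
  by move: wi sx; rewrite drop_oversize ?size_rcons // prefixs0 => /eqP ->; rewrite suffix0s.
have D : drop i (rcons x b) = rcons (drop i x) b by rewrite drop_rcons.
move: wi; rewrite D prefix_rconsE => /orP[wi|/eqP wE].
  by have := lx i; rewrite wi Hi' andbT => /(_ (proj1 (andP Hi))).
by move/negP: sx; apply; rewrite wE -D suffix_drop.
Qed.

Lemma diverge x y : ~~ prefix x y -> ~~ prefix y x ->
  exists l b c x' y', [/\ x = l ++ b :: x', y = l ++ c :: y' & b != c].
Proof.
elim: x y => [|a x IH] [|b y]; rewrite ?prefix0s //.
rewrite !prefix_cons; have [->|ne] := eqVneq a b; last first.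
  by move=> _ _; exists [::], a, b, x, y.
rewrite !andTb => /IH H /H[l [c [d [x' [y' [-> -> ne]]]]]].
by exists (b :: l), c, d, x', y'.
Qed.

Lemma suffix_total p q x : suffix p x -> suffix q x -> size p <= size q -> suffix p q.
Proof. by rewrite /suffix => px qx pq; apply: prefix_total px qx _; rewrite !size_rev. Qed.

Lemma suffix_consE a x y : suffix (a :: x) y -> suffix x y.
Proof. by apply: suffix_trans; exact: suffix_cons. Qed.

Lemma suffix_neq w x : suffix w x -> x != w -> exists a, suffix (a :: w) x.
Proof.
move=> /suffixP[s ->]; elim/last_ind: s => [|s a _]; first by rewrite eqxx.
by exists a; rewrite cat_rcons suffix_suffix.
Qed.

Lemma prefix_neq w x : prefix w x -> x != w -> exists a, prefix (rcons w a) x.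
Proof.
move=> /prefixP[[|a s] ->]; first by rewrite cats0 eqxx.
by exists a; rewrite -cat_rcons prefix_prefix.
Qed.

Lemma suffix_cons_inj a b w x : suffix (a :: w) x -> suffix (b :: w) x -> a = b.
Proof.
move=> ax bx; have := suffix_total ax bx (leqnn _).
by rewrite suffixE subnn drop0 => /eqP[].
Qed.

Lemma prefix_rcons_inj a b w x : prefix (rcons w a) x -> prefix (rcons w b) x -> a = b.
Proof.
move=> ax bx; have := prefix_total ax bx; rewrite !size_rcons leqnn => /(_ isT).
by rewrite prefixE size_rcons -(size_rcons w b) take_size => /eqP /rcons_inj[].
Qed.

Lemma lone_rcons_prefix w b x : lone w x -> prefix (rcons w b) x -> lone (rcons w b) x.
Proof.
move=> /loneP[_ lx] wx; apply/loneP; split=> // i /lx.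
by apply: contra => H; apply: prefix_trans H; exact: prefix_rcons.
Qed.
End Lone.

(** * Factors, right extensions and excess *)

Section Language.
Variables (A : finType) (u : nat -> A).
Implicit Types (w x y z s t : seq A) (a b c : A).
Local Notation factor := (factor u).

Lemma size_window j n : size (window u j n) = n.
Proof. by rewrite size_map size_iota. Qed.

Lemma window_cat j m n : window u j (m + n) = window u j m ++ window u (j + m) n.
Proof. by rewrite /window iotaD map_cat. Qed.

Lemma factor_window j n : factor (window u j n).
Proof. by exists j; rewrite /occurrence size_window. Qed.

Lemma occurrence_cat x y j : occurrence u (x ++ y) j <->
  occurrence u x j /\ occurrence u y (j + size x).
Proof.
rewrite /occurrence size_cat window_cat; split=> [/eqP|[-> ->] //].
by rewrite eqseq_cat ?size_window // => /andP[/eqP-> /eqP->].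
Qed.

Lemma factor_infix x y : infix x y -> factor y -> factor x.
Proof.
by move=> /infixP[s [t ->]] [j /occurrence_cat[_ /occurrence_cat[xj _]]]; exists (j + size s).
Qed.

Lemma factor_rcons w : factor w -> exists b, factor (rcons w b).
Proof.
case=> j wj; exists (u (j + size w)); exists j.
by rewrite -cats1; apply/occurrence_cat; split.
Qed.

(** The truncated predecessor gives 0 on non-factors, so that sums may range over all words of a
    given length. *)
Definition excess x := #|right_extensions u x|.-1.

Lemma in_right_extensions x b : b \in right_extensions u x <-> factor (rcons x b).
Proof. by rewrite inE; split=> /asboolP. Qed.

Lemma card_right_extensions x : factor x -> #|right_extensions u x| = (excess x).+1.
Proof.
move=> /factor_rcons[b xb]; rewrite prednK //; apply/card_gt0P; exists b.
exact/in_right_extensions.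
Qed.

Lemma excess_factor x : 0 < excess x -> factor x.
Proof.
rewrite /excess; case: (posnP #|right_extensions u x|) => [-> //|].
move=> /card_gt0P[b /in_right_extensions xb] _; apply: factor_infix xb.
exact/prefixW/prefix_rcons.
Qed.

Lemma excess_cat s x : excess (s ++ x) <= excess x.
Proof.
rewrite /excess -!subn1 leq_sub2r //; apply: subset_leq_card; apply/fintype.subsetP => b.
move=> /in_right_extensions sxb; apply/in_right_extensions.
by apply: factor_infix sxb; rewrite rcons_cat; exact/suffixW/suffix_suffix.
Qed.

Lemma excess_cons a x : excess (a :: x) <= excess x.
Proof. exact: (excess_cat [:: a]). Qed.

Lemma excess_suffix x y : suffix x y -> excess y <= excess x.
Proof. by move=> /suffixP[s ->]; exact: excess_cat. Qed.

Lemma excess_gt0 x b c :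
  factor (rcons x b) -> factor (rcons x c) -> b != c -> 0 < excess x.
Proof.
move=> /in_right_extensions xb /in_right_extensions xc bc.
suff : 1 < #|right_extensions u x| by rewrite /excess; lia.
by apply/card_gt1P; exists b, c.
Qed.

Lemma excess1_ext x b c d : excess x = 1 -> factor (rcons x b) ->
  factor (rcons x c) -> factor (rcons x d) -> c != b -> d != b -> c = d.
Proof.
move=> x1 xb xc xd cb db; apply/eqP/negPn/negP => cd.
suff : 2 < #|right_extensions u x| by move: x1; rewrite /excess; lia.
apply/card_gt2P; exists b, c, d; split; last by rewrite eq_sym cb cd db.
by split; exact/in_right_extensions.
Qed.

(** The two words part at their longest common prefix [l], which both continue by different letters
    and which is therefore right special. *)
Lemma excess_diverge x y : factor x -> factor y -> ~~ prefix x y -> ~~ prefix y x ->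
  exists l b c, [/\ prefix (rcons l b) x, prefix (rcons l c) y, b != c & 0 < excess l].
Proof.
move=> fx fy nxy nyx; have [l [b [c [x' [y' [xE yE bc]]]]]] := diverge nxy nyx.
have lx : prefix (rcons l b) x by rewrite xE -cat_rcons prefix_prefix.
have ly : prefix (rcons l c) y by rewrite yE -cat_rcons prefix_prefix.
exists l, b, c; split=> //.
by apply: (@excess_gt0 _ b c) => //;
  [apply: factor_infix fx | apply: factor_infix fy]; apply: prefixW.
Qed.

Definition trie_node w x := `[< factor x >] && lone w x.

Lemma trie_nodeP w x : reflect (factor x /\ lone w x) (trie_node w x).
Proof. by apply: (iffP andP) => -[/asboolP]. Qed.

Definition enumerates (s : seq (seq A)) (P : seq A -> Prop) :=
  uniq s /\ forall x, x \in s <-> P x.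

(** * Sums over words of a given length; complexity and bilateral order through excess *)

Definition words n : seq (seq A) := [seq val t | t : n.-tuple A].

Lemma mem_words n x : (x \in words n) = (size x == n).
Proof.
apply/mapP/eqP => [[t _ ->]|xn]; first exact: size_tuple.
have Hn : size x == n by apply/eqP.
by exists (Tuple Hn); rewrite ?mem_enum.
Qed.

Lemma uniq_words n : uniq (words n).
Proof. by rewrite map_inj_uniq ?enum_uniq //; exact: val_inj. Qed.

Lemma words_rcons n : perm_eq (words n.+1) [seq rcons x b | x <- words n, b <- enum A].
Proof.
apply: uniq_perm; rewrite ?uniq_words //.
  apply: allpairs_uniq; rewrite ?uniq_words ?enum_uniq //.
  by move=> [x b] [y c] _ _ /rcons_inj[-> ->].
move=> x; rewrite mem_words; apply/idP/allpairsP => [|[[y b] /= [yn _ ->]]].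
  case/lastP: x => [//|x b]; rewrite size_rcons eqSS => xn.
  by exists (x, b); rewrite /= mem_words mem_enum.
by rewrite size_rcons eqSS -mem_words.
Qed.

Lemma words_cons n : perm_eq (words n.+1) [seq a :: x | x <- words n, a <- enum A].
Proof.
apply: uniq_perm; rewrite ?uniq_words //.
  apply: allpairs_uniq; rewrite ?uniq_words ?enum_uniq //.
  by move=> [x b] [y c] _ _ [-> ->].
move=> x; rewrite mem_words; apply/idP/allpairsP => [|[[y b] /= [yn _ ->]]].
  case: x => [//|b x] xn.
  by exists (x, b); rewrite /= mem_words mem_enum.
by rewrite eqSS -mem_words.
Qed.

Lemma sum_words_rcons n (F : seq A -> nat) :
  \sum_(x <- words n.+1) F x = \sum_(x <- words n) \sum_b F (rcons x b).
Proof.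
rewrite (perm_big _ (words_rcons n)) /= big_allpairs_dep.
by apply: eq_bigr => x _; rewrite big_enum.
Qed.

Lemma sum_words_cons n (F : seq A -> nat) :
  \sum_(x <- words n.+1) F x = \sum_(x <- words n) \sum_a F (a :: x).
Proof.
rewrite (perm_big _ (words_cons n)) /= big_allpairs_dep.
by apply: eq_bigr => x _; rewrite big_enum.
Qed.

Lemma words0 : words 0 = [:: [::]].
Proof.
have := mem_words 0; have := uniq_words 0.
have : size (words 0) = 1 by rewrite size_map -cardE card_tuple.
by case: (words 0) => [|x [|]] //= _ _ /(_ [::]); rewrite inE eqxx => /eqP <-.
Qed.

Lemma card_sum (T : finType) (P : pred T) : #|[set x | P x]| = \sum_x P x.
Proof. by rewrite -sum1_card big_mkcond; apply: eq_bigr => x _; rewrite inE; case: (P x). Qed.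

Lemma complexity_sum n : complexity u n = \sum_(x <- words n) `[< factor x >].
Proof.
by rewrite /complexity card_sum /words big_map big_enum.
Qed.

Lemma complexity0 : complexity u 0 = 1.
Proof.
rewrite complexity_sum words0 big_seq1; case: asboolP => // -[].
exact: (factor_window 0 0).
Qed.

Lemma complexityS n :
  complexity u n.+1 = complexity u n + \sum_(x <- words n) excess x.
Proof.
rewrite !complexity_sum sum_words_rcons -big_split /=; apply: eq_bigr => x _.
rewrite -card_sum -/(right_extensions u x).
case: asboolP => [/card_right_extensions -> // |nx].
case: (posnP (excess x)) => [x0|/excess_factor //]; rewrite x0.
apply/eqP; rewrite cards_eq0; apply/eqP/setP => b; rewrite [RHS]inE.
apply/negP => /in_right_extensions /factor_infix H; apply: nx; apply: H.
exact/prefixW/prefix_rcons.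
Qed.

(** Group the pairs by their left letter: each [a] in the left extensions contributes
    [excess (a :: w) + 1] pairs, any other letter none. *)
Lemma bilateral_order_excess w : factor w ->
  bilateral_order u w = ((\sum_a excess (a :: w))%:Z - (excess w)%:Z)%R.
Proof.
move=> fw; rewrite /bilateral_order (card_right_extensions fw).
suff -> : #|bilateral_extensions u w| = \sum_a excess (a :: w) + #|left_extensions u w|.
  lia.
have -> : #|bilateral_extensions u w| = \sum_a #|right_extensions u (a :: w)|.
  rewrite card_sum -(pair_bigA _ (fun a b => `[<factor (a :: rcons w b)>] : nat)) /=.
  by apply: eq_bigr => a _; rewrite card_sum.
rewrite [#|left_extensions u w|]card_sum -big_split /=; apply: eq_bigr => a _.
case: asboolP => [/card_right_extensions ->|na]; first by rewrite addn1.
case: (posnP (excess (a :: w))) => [x0|/excess_factor //]; rewrite x0.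
apply/eqP; rewrite cards_eq0; apply/eqP/setP => b; rewrite [RHS]inE.
apply/negP => /in_right_extensions /factor_infix H; apply: na; apply: H.
exact/prefixW/prefix_rcons.
Qed.

(** * Return words as leaves of the trie *)

Lemma drop_window j m n : m <= n -> drop m (window u j n) = window u (j + m) (n - m).
Proof. by move=> mn; rewrite -{1}(subnKC mn) window_cat drop_size_cat // size_window. Qed.

Lemma prefix_window w j n : size w <= n ->
  reflect (occurrence u w j) (prefix w (window u j n)).
Proof.
move=> wn; rewrite prefixE -(subnKC wn) window_cat take_size_cat ?size_window //.
exact: eqP.
Qed.

Lemma lone_window w j n : size w <= n ->
  lone w (window u j n) <->
  occurrence u w j /\ forall i, j < i -> i + size w <= j + n -> ~ occurrence u w i.
Proof.
move=> wn; split=> [/loneP[/prefix_window-/(_ wn) wj lw]|[wj lw]].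
  split=> // i ji Hi wi.
  have Hij : 0 < i - j <= size (window u j n) by rewrite size_window; lia.
  move/negP: (lw _ Hij); apply; rewrite drop_window; last by lia.
  by apply/prefix_window; [lia | rewrite subnKC // ltnW].
apply/loneP; split; first exact/prefix_window.
move=> i; rewrite size_window => Hi; apply/negP => H.
have := size_prefix H; rewrite size_drop size_window => Hs.
rewrite drop_window in H; last by lia.
have wi : occurrence u w (j + i) := prefix_window _ Hs H.
apply: (lw (j + i)) => //; first by lia.
by rewrite -addnA leq_add2l -leq_subRL //; case/andP: Hi.
Qed.

(** In [r ++ w] the word [w] occurs only as prefix and as suffix, so deleting the last letter leaves
    a node: return words are the leaves of the trie. *)
Lemma return_wordsP w r : return_words u w r <->
  exists x b, [/\ r ++ w = rcons x b, trie_node w x & factor (rcons x b)].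
Proof.
split=> [[j [k [[jk wj wk ljk] ->]]]|[x [b [E /trie_nodeP[_ lx] [j xj]]]]].
  exists (window u j (k - j + size w).-1), (u (j + (k - j + size w).-1)).
  have E : rcons (window u j (k - j + size w).-1) (u (j + (k - j + size w).-1)) =
           window u j (k - j + size w).
    have -> : k - j + size w = (k - j + size w).-1 + 1 by lia.
    by rewrite addn1 /= -addn1 window_cat cats1.
  rewrite E; split; last exact: factor_window.
    by rewrite window_cat subnKC ?(ltnW jk) // wk.
  apply/trie_nodeP; split; first exact: factor_window.
  apply/lone_window; first by lia.
  by split=> // i ji Hi; apply: ljk; lia.
have wx : size w <= size x by apply/size_prefix/lone_pre.
have sE : size r + size w = (size x).+1 by rewrite -size_cat E size_rcons.
have xE : x = window u j (size x).
  by move: xj; rewrite -cats1 => /occurrence_cat[].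
have [wj lw] : occurrence u w j /\
    forall i, j < i -> i + size w <= j + size x -> ~ occurrence u w i.
  by apply/lone_window; rewrite -?xE.
have [rj wk] : occurrence u r j /\ occurrence u w (j + size r).
  by apply/occurrence_cat; rewrite E.
exists j, (j + size r); split; last by rewrite addKn rj.
by split=> //; [lia | move=> i Hi; apply: lw; lia].
Qed.

(** * Uniform recurrence: finiteness of the tries and the number of return words *)

Hypothesis u_rec : uniformly_recurrent u.

Lemma infix_long w : factor w ->
  exists N, forall v, factor v -> N <= size v -> infix w v.
Proof.
by have [N HN] := u_rec (size w) => fw; exists N => v fv Nv; apply: (HN v).
Qed.

(** By recurrence [w] also occurs at a position at least 1, where a letter precedes it. *)
Lemma factor_cons w : factor w -> exists a, factor (a :: w).
Proof.
move=> /infix_long[M HM].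
have /infixP[s [t E]] := HM _ (factor_window 1 M) (eq_leq (esym (size_window _ _))).
have := factor_window 0 (1 + M); rewrite window_cat E -[window u 0 1]/[:: u 0].
case/lastP: s {E} => [|s a] H; [exists (u 0) | exists a].
  by apply: factor_infix H; exact: prefixW (prefix_prefix (u 0 :: w) t).
by apply: factor_infix H; rewrite cat_rcons catA; exact: (infix_infix _ (a :: w)).
Qed.

(** A node without its first letter is a factor avoiding [w], and recurrence bounds the length of
    such factors. *)
Lemma trie_node_bounded w : factor w ->
  exists N, forall x, trie_node w x -> size x <= N.
Proof.
move=> /infix_long[N HN]; exists N => -[//|a x] /trie_nodeP[fx lx] /=.
rewrite ltnNge; apply/negP => Nx.
have fx' : factor x by apply: factor_infix fx; exact: infix_cons.
have /infixP[s [t xE]] := HN x fx' Nx.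
have := @lone_catK _ w (a :: s) (w ++ t); rewrite /= -xE => /(_ lx (prefix_prefix _ _)).
by [].
Qed.

Lemma enum_trie_nodes w : factor w -> exists s : seq (seq A), enumerates s (trie_node w).
Proof.
move=> /trie_node_bounded[N HN].
exists (undup [seq x <- flatten [seq words n | n <- iota 0 N.+1] | trie_node w x]).
split=> [|x]; first exact: undup_uniq.
rewrite mem_undup mem_filter; split=> [/andP[] //|wx]; rewrite wx andTb.
apply/flattenP; exists (words (size x)); last by rewrite mem_words.
by apply: map_f; rewrite mem_iota ltnS HN.
Qed.

(** Count the children [ch] of all nodes. A node [x] has [excess x + 1] of them; those not ending in
    [w] are the nodes other than the root [w], and those ending in [w] correspond to the return
    words. *)
Lemma count_return_words w (s : seq (seq A)) : factor w -> enumerates s (trie_node w) ->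
  exists rs, [/\ enumerates rs (return_words u w) &
                 size rs = (\sum_(x <- s) excess x).+1].
Proof.
move=> fw [us ms].
pose ch := [seq rcons x b | x <- s, b <- enum (right_extensions u x)].
have mch v : reflect (exists x b, [/\ v = rcons x b, trie_node w x & factor v]) (v \in ch).
  apply: (iffP allpairsPdep) => -[x [b [H1 H2 H3]]]; exists x, b.
    rewrite H3; split=> //; first exact/ms.
    by move: H2; rewrite mem_enum => /in_right_extensions.
  split=> //; first exact/ms.
  by rewrite mem_enum; apply/in_right_extensions; rewrite -H1.
have uch : uniq ch.
  apply: allpairs_uniq_dep => // [x _|]; first exact: enum_uniq.
  by move=> [x b] [y c] _ _ /= /rcons_inj[-> ->].
have sch : size ch = \sum_(x <- s) excess x + size s.
  rewrite size_allpairs_dep sumnE big_map -sum1_size -big_split /=.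
  apply: eq_big_seq => x /ms /trie_nodeP[fx _].
  by rewrite -cardE card_right_extensions // addn1.
have ws : w \in s by apply/ms/trie_nodeP; split=> //; exact: lone_refl.
have pe : perm_eq [seq v <- ch | ~~ suffix w v] (rem w s).
  apply: uniq_perm; rewrite ?filter_uniq ?rem_uniq // => v.
  rewrite mem_filter mem_rem_uniq // inE.
  apply/andP/andP => [[sv /mch[x [b [vE /trie_nodeP[fx lx] fv]]]]|].
    have lv : lone w v.
      by rewrite vE lone_rcons -?vE ?lx //; exact/size_prefix/lone_pre.
    split; last by apply/ms/trie_nodeP.
    by apply: contra sv => /eqP ->; exact: suffix_refl.
  move=> [vw /ms/trie_nodeP[fv lv]]; split.
    by apply: contra vw => /(lone_suffix lv) ->.
  have [a wv] := prefix_neq (lone_pre lv) vw.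
  case/lastP: v vw fv lv wv => [|x b] vw fv lv wv.
    by have := size_prefix wv; rewrite size_rcons.
  apply/mch; exists x, b; split=> //.
  have wx : size w <= size x by have := size_prefix wv; rewrite !size_rcons.
  apply/trie_nodeP; split.
    by apply: factor_infix fv; exact: infix_rcons.
  by move: lv; rewrite lone_rcons // => /andP[].
pose cr := [seq v <- ch | suffix w v].
have crE v : v \in cr -> take (size v - size w) v ++ w = v.
  rewrite mem_filter => /andP[/suffixP[r ->] _].
  by rewrite size_cat addnK take_size_cat.
exists [seq take (size v - size w) v | v <- cr]; split; last first.
  have := count_predC (suffix w) ch; rewrite -!size_filter -/cr (perm_size pe).
  rewrite size_rem // sch size_map => E.
  apply: (@addIn (size s).-1); rewrite E addSnnS prednK //.
  by case: (s) ws.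
split=> [|r].
  rewrite map_inj_in_uniq ?filter_uniq // => v v' /crE E /crE E' H.
  by rewrite -E -E' H.
split=> [/mapP[v vcr rE]|/return_wordsP[x [b [E wx fx]]]].
  apply/return_wordsP; rewrite rE crE //.
  move: vcr; rewrite mem_filter => /andP[_ /mch[x [b [vE wx fv]]]].
  by exists x, b; rewrite -vE.
apply/mapP; exists (r ++ w); last by rewrite size_cat addnK take_size_cat.
by rewrite mem_filter suffix_suffix; apply/mch; exists x, b; rewrite E.
Qed.

(** * The budget, and its derivation from vanishing bilateral orders *)

Definition budget := forall w, factor w ->
  exists s : seq (seq A), enumerates s (trie_node w) /\ \sum_(x <- s) excess x = 2.

Lemma property_R3_budget : property_R 3 u <-> budget.
Proof.
have key w (s : seq (seq A)) : factor w -> enumerates s (trie_node w) ->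
    (return_words u w #= `I_3)%card <-> \sum_(x <- s) excess x = 2.
  move=> fw es; have [rs [[urs mrs] sz]] := count_return_words fw es.
  have -> : return_words u w = [set` rs]%classic.
    by apply/seteqP; split=> r; [move/mrs | move=> /= /mrs].
  have rsI : ([set` rs] #= `I_(size rs))%card.
    have -> : [set` rs]%classic = (nth [::] rs @` `I_(size rs))%classic.
      apply/seteqP; split=> r /= => [rrs|[i irs <-]]; last exact: mem_nth.
      by exists (index r rs); rewrite /= ?index_mem ?nth_index.
    apply: inj_card_eq => i j; rewrite !inE /= => iH jH /eqP.
    by rewrite nth_uniq // => /eqP.
  by rewrite (card_eql rsI) sz; split=> [/card_eq_II[]|->].
split=> [R w fw|B w fw].
  have [s es] := enum_trie_nodes fw.
  by exists s; split=> //; apply/(key w) => //; exact: R.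
have [s [es s2]] := B w fw.
exact/(key w s).
Qed.


(** For a factor this is the vanishing of the bilateral order; for a non-factor both sides are 0. *)
Definition balanced := forall w, \sum_a excess (a :: w) = excess w.

Lemma sum_excess_suffix t n : balanced -> size t <= n ->
  \sum_(x <- words n) suffix t x * excess x = excess t.
Proof.
move=> bal /subnKC <-; elim: (n - size t) => [|k IH].
  rewrite addn0 (bigD1_seq t) ?mem_words ?uniq_words //= suffix_refl mul1n.
  rewrite big_seq_cond big1 ?addn0 // => x /andP[].
  rewrite mem_words => /eqP xt /negP nxt.
  case: (boolP (suffix t x)) => // /suffixP[[|a r] xE]; first by case: nxt; apply/eqP.
  by move: xt; rewrite xE size_cat /=; lia.
rewrite addnS sum_words_cons -{}IH; apply: eq_big_seq => x; rewrite mem_words => /eqP sx.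
rewrite -bal big_distrr /=; apply: eq_bigr => a _; congr (nat_of_bool _ * _).
(* As [x] is at least as long as [t], prepending a letter does not affect whether [t] is a
   suffix. *)
apply/idP/idP => [tax|]; last by move/suffix_trans; apply; exact: suffix_cons.
by apply: suffix_total tax (suffix_cons _ _) _; rewrite sx leq_addr.
Qed.

Lemma lone_suffix_uniq w x t t' :
  lone w t -> lone w t' -> suffix t x -> suffix t' x -> t = t'.
Proof.
wlog le_tt' : t t' / size t <= size t' => [H lt lt' tx t'x|lt lt' tx t'x].
  by have [|/ltnW] := leqP (size t) (size t') => /H; [apply | move=> ->].
have /suffixP[r t'E] := suffix_total tx t'x le_tt'.
by move: lt'; rewrite t'E => lt'; rewrite (lone_catK lt' (lone_pre lt)).
Qed.

(** Double counting, weighted by [excess x], of the pairs of a node [t] and a word [x] of length [N]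
    ending in [t]. *)
Lemma balanced_budget : balanced -> excess [::] = 2 -> budget.
Proof.
move=> bal e0 w fw; have [s es] := enum_trie_nodes fw; exists s; split=> //.
have [N0 HN0] := infix_long fw; have [N1 HN1] := trie_node_bounded fw.
(* [N0] makes [w] occur in every factor of length [N]; [N1] makes every node at most that long. *)
pose N := N0 + N1.
rewrite -e0 -(@sum_excess_suffix _ N) //.
rewrite (eq_big_seq (fun t => \sum_(x <- words N) suffix t x * excess x)); last first.
  move=> t /(proj2 es) /HN1 tN; rewrite sum_excess_suffix //.
  exact: leq_trans tN (leq_addl _ _).
rewrite exchange_big; apply: eq_big_seq => x; rewrite mem_words => /eqP xN.
rewrite suffix0s mul1n -big_distrl /=.
case: (posnP (excess x)) => [->|/excess_factor fx]; first by rewrite muln0.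
rewrite -[RHS]mul1n; congr (_ * _).
have /last_occurrence[r [t [xE lt]]] : infix w x by apply: HN0 => //; rewrite xN leq_addr.
have tx : suffix t x by rewrite xE suffix_suffix.
have ts : t \in s.
  by apply/(proj2 es)/trie_nodeP; split=> //; apply: factor_infix fx; exact: suffixW.
rewrite (bigD1_seq t) ?(proj1 es) //= tx big_seq_cond big1 ?addn0 // => t' /andP[].
move=> /(proj2 es) /trie_nodeP[_ lt'] ne; case: (boolP (suffix t' x)) => // t'x.
by move: ne; rewrite (lone_suffix_uniq lt lt' tx t'x) eqxx.
Qed.

Lemma balanced_complexity n : excess [::] = 2 -> balanced -> complexity u n = 2 * n + 1.
Proof.
move=> e0 bal; elim: n => [|n IH]; first by rewrite complexity0.
rewrite complexityS IH.
have := @sum_excess_suffix [::] n bal (leq0n _); rewrite e0.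
under eq_bigr do rewrite suffix0s mul1n.
by move=> ->; lia.
Qed.

(** The total excess is 2 at every length. Without weak factors it cannot drop under left extension
    of any single word, so one strict increase would raise the next total above 2. *)
Lemma complexity_balanced : (forall n, complexity u n = 2 * n + 1) ->
  ~ (exists w, weak_bispecial u w) -> excess [::] = 2 /\ balanced.
Proof.
move=> C nweak; have sum2 n : \sum_(x <- words n) excess x = 2.
  by have := complexityS n; rewrite !C; lia.
split; first by have := sum2 0; rewrite words0 big_seq1.
have le w : excess w <= \sum_a excess (a :: w).
  case: (posnP (excess w)) => [->|/excess_factor fw] //.
  rewrite leqNgt; apply/negP => lt; apply: nweak; exists w; split=> //.
  by rewrite bilateral_order_excess //; lia.
move=> w; apply/eqP; rewrite eqn_leq le andbT leqNgt; apply/negP => lt.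
have := sum2 (size w).+1; rewrite sum_words_cons -(sum2 (size w)).
rewrite (bigD1_seq w) ?mem_words ?uniq_words //=.
rewrite [RHS](bigD1_seq w) ?mem_words ?uniq_words //=.
have : \sum_(x <- words (size w) | x != w) excess x <=
       \sum_(x <- words (size w) | x != w) \sum_a excess (a :: x) by apply: leq_sum.
lia.
Qed.

(** * From the budget to vanishing bilateral orders *)

Lemma trie_node_refl w : factor w -> trie_node w w.
Proof. by move=> fw; apply/trie_nodeP; split=> //; exact: lone_refl. Qed.

Lemma trie_node_prefix w x y :
  trie_node w y -> prefix x y -> size w <= size x -> trie_node w x.
Proof.
move=> /trie_nodeP[fy ly] xy wx; apply/trie_nodeP; split.
  by apply: factor_infix fy; exact: prefixW.
exact: lone_prefix ly xy wx.
Qed.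

Lemma trie_node_size w x : trie_node w x -> size w <= size x.
Proof. by move=> /trie_nodeP[_ /lone_pre/size_prefix]. Qed.

Lemma trie_node_suffix w x : 0 < excess x -> infix w x ->
  exists t, [/\ suffix t x, trie_node w t & 0 < excess t].
Proof.
move=> ex /last_occurrence[s [t [xE lt]]]; exists t.
have tx : suffix t x by rewrite xE suffix_suffix.
have et : 0 < excess t by exact: leq_trans ex (excess_suffix tx).
by split=> //; apply/trie_nodeP; split=> //; exact: excess_factor.
Qed.

Section Budget.
Hypothesis bud : budget.

Lemma budget_le w (r : seq (seq A)) :
  uniq r -> (forall x, x \in r -> trie_node w x) -> \sum_(x <- r) excess x <= 2.
Proof.
case: r => [|x0 r0] ur sub; first by rewrite big_nil.
have /trie_nodeP[fx0 lx0] := sub x0 (mem_head _ _).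
have fw : factor w by apply: factor_infix fx0; exact/prefixW/lone_pre.
have [s [[us ms] <-]] := bud fw.
have rs : perm_eq [seq x <- s | x \in x0 :: r0] (x0 :: r0).
  apply: uniq_perm => [||x]; rewrite ?filter_uniq // mem_filter.
  by apply: andb_idr => /sub wx; exact/ms.
by rewrite -(perm_big _ rs) big_filter [leqRHS](bigID (mem (x0 :: r0))) leq_addr.
Qed.

Lemma budget_pair w x y t : trie_node w x -> trie_node w y -> trie_node w t ->
  x != y -> 0 < excess x -> 0 < excess y -> 0 < excess t -> t = x \/ t = y.
Proof.
move=> wx wy wt xy ex ey et.
have [->|tx] := eqVneq t x; first by left.
have [->|ty] := eqVneq t y; first by right.
have : \sum_(v <- [:: t; x; y]) excess v <= 2.
  apply: (@budget_le w); first by rewrite /= !inE negb_or tx ty xy.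
  by move=> v; rewrite !inE => /or3P[] /eqP ->.
by rewrite !big_cons big_nil; lia.
Qed.

(** One unit of the budget remains, and a single further node must carry it. *)
Lemma budget_other w t : trie_node w t -> excess t = 1 ->
  exists x, [/\ trie_node w x, x != t, excess x = 1 &
             forall v, trie_node w v -> 0 < excess v -> v = t \/ v = x].
Proof.
move=> wt et; have /trie_nodeP[ft lt] := wt.
have fw : factor w by apply: factor_infix ft; exact/prefixW/lone_pre.
have [s [[us ms] sum2]] := bud fw.
have ts : t \in s by apply/ms.
have : \sum_(x <- s | x != t) excess x != 0.
  move: sum2; rewrite (bigD1_seq t) //= et => /eqP.
  by rewrite -[2]/(1 + 1) eqn_add2l => /eqP ->.
rewrite sum_nat_seq_neq0 => /hasP[x /ms wx /andP[xt]]; rewrite -lt0n => ex.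
have x1 : excess x = 1.
  have : \sum_(v <- [:: t; x]) excess v <= 2.
    apply: (@budget_le w); first by rewrite /= !inE eq_sym xt.
    by move=> v; rewrite !inE => /orP[] /eqP ->.
  by rewrite !big_cons big_nil; lia.
exists x; split=> // v wv ev; apply: (@budget_pair w) => //; last by rewrite et.
by rewrite eq_sym.
Qed.

(* The only right special node other than z in the trie of z is x, and the
   budget of the trie of z b leaves room for exactly one y besides x; following
   y from its prefix z b one meets x before coming back to z. *)
Record fork z b x y : Prop := Fork {
  fork_first : trie_node z x;
  fork_excess : 0 < excess x;
  fork_letter : prefix (rcons z b) x;
  fork_first_uniq : forall t, trie_node z t -> 0 < excess t -> t = z \/ t = x;
  fork_back_excess : 0 < excess y;
  fork_prefix : prefix x y;
  fork_suffix : suffix z y;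
  fork_back_uniq :
    forall t, trie_node (rcons z b) t -> 0 < excess t -> t = x \/ t = y }.

Lemma excess1_fork z : excess z = 1 -> exists b x y, fork z b x y.
Proof.
move=> z1; have fz : factor z by apply: excess_factor; rewrite z1.
have [x [zx xz x1 ux]] := budget_other (trie_node_refl fz) z1.
have /trie_nodeP[fx lx] := zx.
have [b zbx] := prefix_neq (lone_pre lx) xz.
have zbx1 : trie_node (rcons z b) x.
  by apply/trie_nodeP; split=> //; exact: lone_rcons_prefix.
have [y [zby yx y1 uy]] := budget_other zbx1 x1.
have /trie_nodeP[fy ly] := zby.
have zy : prefix z y by apply: prefix_trans (lone_pre ly); exact: prefix_rcons.
have syx l : prefix (rcons z b) l -> prefix l x -> 0 < excess l -> l = x.
  move=> zl lx' el; have zl' := size_prefix zl; rewrite size_rcons in zl'.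
  have zfl : trie_node z l by apply: trie_node_prefix zx lx' _; exact: ltnW.
  by case: (ux l zfl el) => // lE; move: zl'; rewrite lE ltnn.
exists b, x, y; split=> //; rewrite ?x1 ?y1 //.
(* If [y] stopped or branched off before the end of [x], the word reached there would be a right
   special node of [z] beyond [z], hence [x] by [syx]. Within [rcons z b] the two words agree. *)
- have [//|nxy] := boolP (prefix x y).
  have [/syx E|nyx] := boolP (prefix y x).
    by move: yx; rewrite E ?eqxx ?y1 //; exact: lone_pre.
  have [l [c [d [lx' ly' cd el]]]] := excess_diverge fx fy nxy nyx.
  have lpx : prefix l x by apply: prefix_trans lx'; exact: prefix_rcons.
  have lpy : prefix l y by apply: prefix_trans ly'; exact: prefix_rcons.
  have [zbl|lz] := leqP (size (rcons z b)) (size l); last rewrite size_rcons in lz.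
    have lE : l = x := syx l (prefix_total zbx lpx zbl) lpx el.
    by rewrite -lE lpy in nxy.
  have p1 : prefix (rcons l c) (rcons z b).
    by apply: prefix_total lx' zbx _; rewrite !size_rcons.
  have p2 : prefix (rcons l d) (rcons z b).
    by apply: prefix_total ly' (lone_pre ly) _; rewrite !size_rcons.
  by move: cd; rewrite (prefix_rcons_inj p1 p2) eqxx.
(* The last occurrence of [z] in [y] starts a right special node, [z] or [x]. It is not [x]: then
   [rcons z b] would begin there, forcing [y = x]. *)
- have ey : 0 < excess y by rewrite y1.
  have [t [ty zt et]] := trie_node_suffix ey (prefixW zy).
  case: (ux t zt et) => [<- //|tE]; exfalso.
  move/suffixP: ty => [r yE]; rewrite tE in yE.
  have := ly; rewrite yE => ly'; have r0 := lone_catK ly' zbx.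
  by move: yx; rewrite yE r0 eqxx.
Qed.

(** The trie of a factor of length [n] has only nodes at least that long, and a nonzero budget. *)
Lemma long_special n : exists z, n <= size z /\ 0 < excess z.
Proof.
have [s [[us ms] sum2]] := bud (factor_window 0 n).
have : \sum_(x <- s) excess x != 0 by rewrite sum2.
rewrite sum_nat_seq_neq0 => /hasP[z /ms/trie_node_size nz /=].
by rewrite size_window in nz; rewrite -lt0n => ez; exists z.
Qed.

Lemma infix_long_all (f : A -> seq A) :
  exists N, forall a v, factor (f a) -> factor v -> N <= size v -> infix (f a) v.
Proof.
have /fin_all_exists[N HN] : forall a, exists N,
    forall v, factor (f a) -> factor v -> N <= size v -> infix (f a) v.
  move=> a; case: (asboolP (factor (f a))) => [/infix_long[N HN]|nf].
    by exists N => v _; exact: HN.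
  by exists 0 => v /nf.
exists (\max_a N a) => a v fa fv Nv; apply: HN => //.
by apply: leq_trans Nv; exact: leq_bigmax.
Qed.

(* All right special words containing w end with w; let c w end a long one.
   For a <> c with a w right special, the fork of a w passes through c w and
   comes back to a w, which spends one unit of the budget of c w; hence
   sum_a excess (a w) is at most the budget of c w. *)
Lemma excess2_balanced w : excess w = 2 -> \sum_a excess (a :: w) = 2.
Proof.
move=> w2; have fw : factor w by apply: excess_factor; rewrite w2.
have endw t : 0 < excess t -> infix w t -> suffix w t.
  move=> et wt; have [v [vt wv ev]] := trie_node_suffix et wt.
  have [<- //|vw] := eqVneq v w.
  have : \sum_(x <- [:: v; w]) excess x <= 2.
    apply: (@budget_le w); first by rewrite /= inE vw.
    by move=> x; rewrite !inE => /orP[] /eqP -> //; exact: trie_node_refl.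
  by rewrite !big_cons big_nil w2; lia.
have endaw t c : 0 < excess t -> prefix (c :: w) t -> exists a, suffix (a :: w) t.
  move=> et cwt; apply: suffix_neq.
    by apply: endw => //; apply: infix_trans (prefixW cwt); exact: infix_cons.
  by apply: contraTneq cwt => ->; apply/negP => /size_prefix /=; rewrite ltnn.
have [N HN] := infix_long_all (fun a => a :: w).
(* [N] makes [z] contain every factor [a :: w]; the other summand makes it longer than [w], so that
   a letter precedes its final [w]. *)
have [z [zN ez]] := long_special (N + (size w).+1).
have zall a : factor (a :: w) -> infix (a :: w) z.
  by move=> fa; apply: HN => //; [exact: excess_factor | apply: leq_trans zN; exact: leq_addr].
have [c cz] : exists c, suffix (c :: w) z.
  have [a fa] := factor_cons fw.
  apply: suffix_neq.
    by apply: endw => //; apply: infix_trans (zall a fa); exact: infix_cons.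
  by apply: contraTneq zN => ->; rewrite -ltnNge addnS ltnS leq_addl.
have ec : 0 < excess (c :: w) by exact: leq_trans ez (excess_suffix cz).
have fcw := excess_factor ec.
have [s [[us ms] sum2]] := bud fcw.
apply/eqP; rewrite eqn_leq; apply/andP; split; last first.
  rewrite (bigD1 c) //=.
  (* If [c :: w] has excess only 1, the other right special node of its trie ends in some [a :: w].
     Here [a] differs from [c], since [c :: w] occurs in that node only as a prefix. *)
  have [c2|c1] := ltnP 1 (excess (c :: w)); first exact: leq_trans c2 (leq_addr _ _).
  have {}c1 : excess (c :: w) = 1 by apply/eqP; rewrite eqn_leq c1.
  have [t [ct tc t1 _]] := budget_other (trie_node_refl fcw) c1.
  have /trie_nodeP[_ lt] := ct.
  have [|a at_] := endaw t c _ (lone_pre lt); first by rewrite t1.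
  have ac : a != c by apply: contra tc => /eqP ac; apply/eqP/lone_suffix; rewrite -?ac // ac.
  rewrite (bigD1 a) //= c1; have := excess_suffix at_; rewrite t1; lia.
rewrite -sum2.
have main a : excess (a :: w) <= \sum_(t <- s) suffix (a :: w) t * excess t.
  case: (posnP (excess (a :: w))) => [->//|ea].
  suff [t [ta ct et]] : exists t, [/\ suffix (a :: w) t, trie_node (c :: w) t &
      excess (a :: w) <= excess t].
    rewrite (bigD1_seq t) //=; last exact/ms.
    by rewrite ta mul1n; exact: leq_trans et (leq_addr _ _).
  have [->|ac] := eqVneq a c.
    by exists (c :: w); split=> //; [exact: suffix_refl | exact: trie_node_refl].
  (* [za] ends in [c :: w], so it differs from [a :: w] and shares its budget; it is thus the [x] of
     the fork of [a :: w]. Cutting [y] at its last [c :: w] gives [t]. *)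
  have [za [zaz fza eza]] := trie_node_suffix ez (zall a (excess_factor ea)).
  have cza : suffix (c :: w) za by apply: suffix_total cz zaz _; exact: trie_node_size fza.
  have zane : za != a :: w.
    apply: contra ac => /eqP zE; rewrite zE in cza.
    by rewrite (suffix_cons_inj cza (suffix_refl _)).
  have a1 : excess (a :: w) = 1.
    have : \sum_(x <- [:: za; a :: w]) excess x <= 2.
      apply: (@budget_le (a :: w)); first by rewrite /= inE zane.
      move=> x; rewrite !inE => /orP[] /eqP -> //.
      exact/trie_node_refl/excess_factor.
    by rewrite !big_cons big_nil; lia.
  have [b [x [y fk]]] := excess1_fork a1.
  have xza : x = za.
    case: (fork_first_uniq fk fza eza) => // E; by rewrite E eqxx in zane.
  have cy : infix (c :: w) y.
    apply: infix_trans (prefixW (fork_prefix fk)); rewrite xza; exact: suffixW.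
  have [t [ty ct et]] := trie_node_suffix (fork_back_excess fk) cy.
  exists t; split=> //; last by rewrite a1.
  by apply: suffix_total (fork_suffix fk) ty _; exact: trie_node_size ct.
apply: (@leq_trans (\sum_a \sum_(t <- s) suffix (a :: w) t * excess t)).
  exact: leq_sum.
(* Each node ends in [a :: w] for at most one letter [a], so it is charged at most once. *)
rewrite exchange_big /=; apply: leq_sum => t _; rewrite -big_distrl /=.
rewrite -[leqRHS]mul1n leq_mul2r; apply/orP; right.
case: (pickP (fun a => suffix (a :: w) t)) => [a at_|none]; last first.
  by rewrite big1 // => a _; rewrite none.
rewrite (bigD1 a) //= at_ big1 // => d da; case: (boolP (suffix (d :: w) t)) => // dt.
by move: da; rewrite (suffix_cons_inj dt at_) eqxx.
Qed.

(* The fork of w comes back to w through a letter d. For d' <> d, right special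
   words ending in d' w avoid w b, so they run along the unique return word to w
   not starting with b. If d' w were right special, its fork would leave d' w
   along this return word to a letter other than d', yet also end with it
   in d' w. *)
Lemma excess1_balanced w : excess w = 1 -> \sum_a excess (a :: w) = 1.
Proof.
move=> w1; have fw : factor w by apply: excess_factor; rewrite w1.
have [b [x [y fk]]] := excess1_fork w1.
have sx := size_prefix (fork_letter fk); rewrite size_rcons in sx.
have /trie_nodeP[fx lx] := fork_first fk.
have wbx := prefixW (fork_letter fk).
have [d dy] : exists d, suffix (d :: w) y.
  apply: suffix_neq (fork_suffix fk) _.
  by apply: contraTneq (size_prefix (fork_prefix fk)) => ->; rewrite -ltnNge.
have ed : excess (d :: w) = 1.
  apply/eqP; rewrite eqn_leq -{1}w1 excess_cons.
  exact: leq_trans (fork_back_excess fk) (excess_suffix dy).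
rewrite (bigD1 d) //= ed big1 // => d' dd'.
apply/eqP; rewrite -leqn0 leqNgt; apply/negP => ed'.
have {}ed' : excess (d' :: w) = 1.
  by apply/eqP; rewrite eqn_leq ed' andbT -w1 excess_cons.
have avoid t : 0 < excess t -> suffix (d' :: w) t -> ~~ infix (rcons w b) t.
  move=> et d't; apply/negP => wbt.
  (* Cut at the last [rcons w b]: the resulting node is [x] or [y], yet ends in [d' :: w]. But [x]
     contains [w] only as a proper prefix, and [y] ends in [d :: w]. *)
  have [v [vt wbv ev]] := trie_node_suffix et wbt.
  have d'v : suffix (d' :: w) v.
    by apply: suffix_total d't vt _; have := trie_node_size wbv; rewrite size_rcons.
  case: (fork_back_uniq fk wbv ev) => vE; rewrite {}vE in d'v.
    have := lone_suffix lx (suffix_consE d'v) => xE.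
    by move: sx; rewrite xE ltnn.
  by move: dd'; rewrite (suffix_cons_inj d'v dy) eqxx.
have [b' [x' [y' fk']]] := excess1_fork ed'.
have ny' := avoid y' (fork_back_excess fk') (fork_suffix fk').
have nx' : ~~ infix (rcons w b) x'.
  by apply: contra ny' => /infix_trans; apply; exact/prefixW/(fork_prefix fk').
have /trie_nodeP[fx' lx'] := fork_first fk'.
have sx' := size_prefix (fork_letter fk'); rewrite size_rcons /= in sx'.
(* [q] is right special, begins with [w] and avoids both [rcons w b] and [d' :: w]. *)
have [q xE] : exists q, x' = d' :: q.
  by case: (x') (lone_pre lx') => [|e q] //; rewrite prefix_cons => /andP[/eqP -> _]; exists q.
have wq : prefix w q by have := lone_pre lx'; rewrite xE prefix_cons eqxx.
have eq_ : 0 < excess q.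
  by apply: leq_trans (fork_excess fk') _; rewrite xE excess_cons.
have nq : ~~ infix (rcons w b) q.
  by apply: contra nx' => /infix_trans; apply; rewrite xE infix_cons.
have qsz : size w < size q by move: sx'; rewrite xE.
have noq : ~~ infix (d' :: w) q.
  apply/negP => /infixP[r [r' qE]].
  have x'E : x' = (d' :: r) ++ (d' :: w) ++ r' by rewrite xE qE.
  by rewrite x'E in lx'; have := lone_catK lx' (prefix_prefix _ _).
have fkw t : trie_node w t -> 0 < excess t -> ~~ infix (rcons w b) t -> t = w.
  move=> wt et nt; case: (fork_first_uniq fk wt et) => // tE.
  by move: nt; rewrite tE wbx.
(* [p0] starts at the last occurrence of [w] in [y'] before the final one, so [rcons p0 e] is a
   return word followed by [w]. *)
have [p0 [e [p0w p0y']]] : exists p0 e, lone w p0 /\ suffix (rcons p0 e) y'.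
  have := prefix_trans (fork_letter fk') (fork_prefix fk').
  case/lastP: (y') => [|v e] //.
  rewrite prefix_rconsE => H; have : infix w v.
    have d'v : prefix (d' :: w) v.
      case/orP: H => [|/eqP/rcons_inj[<- _]]; last exact: prefix_refl.
      by apply: prefix_trans; exact: prefix_rcons.
    by apply: infix_trans (prefixW d'v); exact: infix_cons.
  move=> /last_occurrence[s [p0 [vE lp0]]]; exists p0, e.
  by rewrite vE rcons_cat suffix_suffix.
set p := rcons p0 e in p0y'.
have p0p : prefix p0 p := prefix_rcons p0 e.
have fp : factor p.
  by apply: factor_infix (suffixW p0y') _; apply/excess_factor/(fork_back_excess fk').
have wp0 := lone_pre p0w.
have fwp0 : trie_node w p0.
  by apply/trie_nodeP; split=> //; exact: factor_infix (prefixW p0p) fp.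
have d'p : suffix (d' :: w) p.
  apply: suffix_total (fork_suffix fk') p0y' _.
  by rewrite size_rcons ltnS; exact: size_prefix.
have np : ~~ infix (rcons w b) p.
  by apply: contra ny' => /infix_trans; apply; exact: suffixW.
have npq : ~~ prefix p q.
  by apply: contra noq => /prefixW; apply: infix_trans; exact: suffixW.
have nqp : ~~ prefix q p.
  apply/negP; rewrite prefix_rconsE => /orP[qp|/eqP qp].
    have qE := fkw q (trie_node_prefix fwp0 qp (ltnW qsz)) eq_ nq.
    by rewrite qE ltnn in qsz.
  by rewrite /p -qp prefix_refl in npq.
(* [p] and [q] both begin with [w], and by [fkw] they can only branch right after it. Then [b], [c1]
   and [c2] would be three right extensions of [w], against excess 1. *)
have [l [c1 [c2 [lq lp c12 el]]]] := excess_diverge (excess_factor eq_) fp nqp npq.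
have [wl|lw] := leqP (size w) (size l).
  have lp0 : prefix l p0.
    apply: prefix_total (prefix_trans (prefix_rcons _ _) lp) p0p _.
    by have := size_prefix lp; rewrite !size_rcons.
  have lE : l = w.
    apply: fkw => //; first exact: trie_node_prefix fwp0 lp0 wl.
    apply: contra nq => /infix_trans; apply; apply: prefixW.
    by apply: prefix_trans lq; exact: prefix_rcons.
  rewrite lE in lq lp.
  move: c12; rewrite (excess1_ext w1 (b := b) (c := c1) (d := c2)) ?eqxx //.
  - exact: factor_infix wbx fx.
  - exact: factor_infix (prefixW lq) (excess_factor eq_).
  - exact: factor_infix (prefixW lp) fp.
  - by apply: contra nq => /eqP <-; exact: prefixW.
  - by apply: contra np => /eqP <-; exact: prefixW.
have p1 : prefix (rcons l c1) w by apply: prefix_total lq wq _; rewrite size_rcons.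
have p2 : prefix (rcons l c2) w.
  by apply: prefix_total lp (prefix_trans wp0 p0p) _; rewrite size_rcons.
by move: c12; rewrite (prefix_rcons_inj p1 p2) eqxx.
Qed.

Lemma budget_balanced : balanced.
Proof.
move=> w; case: (posnP (excess w)) => [w0|ew].
  by rewrite w0 big1 // => a _; apply/eqP; rewrite -leqn0 -w0 excess_cons.
have fw := excess_factor ew.
have : \sum_(x <- [:: w]) excess x <= 2.
  by apply: (@budget_le w) => // x; rewrite inE => /eqP ->; exact: trie_node_refl.
rewrite big_seq1; case E : (excess w) ew => [|[|[|]]] // _ _.
  exact: excess1_balanced.
exact: excess2_balanced.
Qed.

(** The empty word occurs at every position, so its trie consists of the root alone. *)
Lemma budget_excess0 : excess [::] = 2.
Proof.
have f0 : factor [::] := factor_window 0 0.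
have [s [[us ms] <-]] := bud f0; rewrite (perm_big [:: [::]]) ?big_seq1 //.
apply: uniq_perm => // x; rewrite inE; apply/idP/eqP => [/ms/trie_nodeP[_ lx]|->].
  by apply: lone_suffix lx _; exact: suffix0s.
exact/ms/trie_node_refl.
Qed.
End Budget.

End Language.

Theorem theorem5p7 (A : finType) (u : nat -> A)
    (u_unif_rec : uniformly_recurrent u) :
  property_R 3 u <->
  (forall n : nat, complexity u n = 2 * n + 1) /\
  ~ (exists w : seq A, weak_bispecial u w).
Proof.
split=> [/(property_R3_budget u_unif_rec) bud | [C nweak]].
  have bal := budget_balanced u_unif_rec bud.
  split=> [n|[w [fw]]]; first exact: balanced_complexity (budget_excess0 bud) bal.
  by rewrite bilateral_order_excess // bal GRing.subrr Order.POrderTheory.ltxx.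
have [e0 bal] := complexity_balanced C nweak.
exact/(property_R3_budget u_unif_rec)/balanced_budget.
Qed.
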